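(* For every nonnegative integer $n$, $$\sum_{\substack{i+j=n\\ i,j\ge 0}} C_{2i}\,B_{2j}=4^n B_n .$$
   Context: For a nonnegative integer $m$, $C_m=\frac{1}{m+1}\binom{2m}{m}$ is the $m$th Catalan number and $B_m=\binom{2m}{m}$ is the $m$th central binomial coefficient. The sum runs over all pairs of nonnegative integers $(i,j)$ with $i+j=n$. *)

(* Defs.v *)
From mathcomp Require Import all_boot all_order all_algebra.

Set Implicit Arguments.
Unset Strict Implicit.
Unset Printing Implicit Defensive.

Import GRing.Theory.
Local Open Scope ring_scope.

Definition central_binom (m : nat) : nat := 'C(2 * m, m).

(* Rational-valued, so that the division by m + 1 is exact by construction
   rather than the truncated division of nat. *)
Definition catalan (m : nat) : rat := (m.+1)%:R^-1 * ('C(2 * m, m))%:R.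

(* Main.v *)
Require Import Defs.
From mathcomp Require Import all_boot all_order all_algebra.
From mathcomp Require Import ring zify.

(** With b(x) = (1-4x)^(-1/2) the generating function of the central binomials
    and s(x) = (1-4x) b(x), the even part of the Catalan generating function is
    (s(-x) - s(x)) / (4x).  As s(x) b(x) = 1, its product with the even part
    (b(x) + b(-x)) / 2 of b is b(x) b(-x), which is (1-16x^2)^(-1/2).  Both facts
    about b follow from the equation (1-4x) b' = 2b, and all power series are
    replaced by polynomials truncated at a sufficiently high degree. *)

Set Implicit Arguments.
Unset Strict Implicit.
Unset Printing Implicit Defensive.

Import GRing.Theory.
Local Open Scope ring_scope.

Lemma central_binomS k :
  (k.+1 * central_binom k.+1 = (4 * k + 2) * central_binom k)%N.
Proof.
rewrite /central_binom; have -> : (2 * k.+1 = (2 * k).+2)%N by lia.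
have h1 := mul_bin_diag (2 * k).+2 k.
have h2 := mul_bin_diag (2 * k).+1 k.
have h3 : 'C((2 * k).+1, k.+1) = 'C((2 * k).+1, k).
  rewrite -[LHS]bin_sub; last lia.
  by congr 'C(_, _); lia.
rewrite /= in h1 h2; rewrite h3 in h2; nia.
Qed.

Lemma central_binomS_rat k :
  k.+1%:R * (central_binom k.+1)%:R
  = (4 * k%:R + 2) * (central_binom k)%:R :> rat.
Proof.
by rewrite -natrM central_binomS natrM natrD natrM.
Qed.

(** Up to the factor -2, Catalan numbers are the nonconstant coefficients of [(1-4x) b(x)]. *)
Lemma catalanE k :
  catalan k = (4 * (central_binom k)%:R - (central_binom k.+1)%:R) / 2.
Proof.
have k0 : (k.+1%:R : rat) != 0 by rewrite Num.Theory.pnatr_eq0.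
apply: (mulfI k0); rewrite /catalan mulrA divff // mul1r.
rewrite mulrA mulrBr central_binomS_rat -natr1 /central_binom.
by field.
Qed.

(** Truncation of [b(ex)]; the values 1 and -1 of [e] give [b(x)] and [b(-x)]. *)
Definition bpoly (e : rat) m : {poly rat} :=
  \poly_(k < m.+1) (e ^+ k * (central_binom k)%:R).

Lemma coef_bpoly e m k : (k <= m)%N ->
  (bpoly e m)`_k = e ^+ k * (central_binom k)%:R.
Proof. by move=> km; rewrite coef_poly ltnS km. Qed.

Lemma bpoly_ode e m : exists r : {poly rat},
  (1 - 4 * e%:P * 'X) * (bpoly e m)^`() = 2 * e%:P * bpoly e m + r * 'X^m.
Proof.
(* Truncation loses only the term [(m+1) B_{m+1} e^(m+1)] of the derivative, in degree [m]; the
   recurrence rewrites it through [B_m]. *)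
exists (- ((4 * m%:R + 2) * e ^+ m.+1 * (central_binom m)%:R))%:P.
have -> : (1 - 4 * e%:P * 'X) * (bpoly e m)^`()
    = (bpoly e m)^`() - (4 * e)%:P * ((bpoly e m)^`() * 'X).
  by rewrite polyCM (_ : 4%:P = 4); [ring | rewrite rmorph_nat].
have -> : 2 * e%:P = (2 * e)%:P :> {poly rat} by rewrite polyCM rmorph_nat.
apply/polyP => k.
rewrite coefB coefD !coefCM coefMX coefXn !coef_deriv.
have -> : (if k == 0%N then 0 else (bpoly e m)`_(k.-1).+1 *+ (k.-1).+1)
    = (bpoly e m)`_k *+ k by case: k => //=; rewrite mulr0n.
have hS := central_binomS_rat k.
rewrite !coef_poly !ltnS -(mulr_natl _ k) -(mulr_natl _ k.+1).
case: (ltngtP k m) => [km|km|->].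
- transitivity (e ^+ k.+1 * (k.+1%:R * (central_binom k.+1)%:R)
    - 4 * e * (k%:R * (e ^+ k * (central_binom k)%:R))); first ring.
  by rewrite hS exprS /=; ring.
- by rewrite /=; ring.
by rewrite /= exprS; ring.
Qed.

(** By the differential equation, the derivative of [(1-4ex) b(ex)^2] vanishes below degree [m]. *)
Lemma coef_bpoly_sqr e m k : (k < m)%N ->
  ((1 - 4 * e%:P * 'X) * bpoly e m * bpoly e m)`_k.+1 = 0.
Proof.
move=> km; have [r hr] := bpoly_ode e m.
set p := bpoly e m in hr *.
have hd : ((1 - 4 * e%:P * 'X) * p * p)^`() = (2 * r * p) * 'X^m.
  have -> : 4 * e%:P = (4 * e)%:P :> {poly rat} by rewrite polyCM rmorph_nat.
  rewrite !derivM derivB derivC derivM derivC derivX mul0r mulr1 !add0r.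
  transitivity (- (4 * e)%:P * p * p
    + 2 * p * ((1 - (4 * e)%:P * 'X) * p^`())); first ring.
  by rewrite polyCM rmorph_nat hr; ring.
have := congr1 (fun f : {poly rat} => f`_k) hd.
rewrite coefMXn km coef_deriv => /eqP.
by rewrite Num.Theory.mulrn_eq0 => /eqP.
Qed.

(** Modulo [X^m], [f = b(x) b(-x)] satisfies [(1-16x^2) f' = 16x f]. In degree [2n+1] this reads
    [(2n+2) f_{2n+2} = 16 (2n+1) f_{2n}], whence the induction. *)
Lemma coef_bpoly_mulN m n : (2 * n <= m)%N ->
  (bpoly 1 m * bpoly (-1) m)`_(2 * n) = 4 ^+ n * (central_binom n)%:R.
Proof.
have [r hr] := bpoly_ode 1 m; have [s hs] := bpoly_ode (-1) m.
set p := bpoly 1 m in hr *; set q := bpoly (-1) m in hs *.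
have hd : (p * q)^`() - 16%:P * ((p * q)^`() * 'X^2)
    = 16%:P * (p * q * 'X)
      + ((1 + 4 * 'X) * q * r + (1 - 4 * 'X) * p * s) * 'X^m.
  rewrite rmorph_nat derivM.
  transitivity ((1 + 4 * 'X) * q * ((1 - 4 * 1%:P * 'X) * p^`())
    + (1 - 4 * 'X) * p * ((1 - 4 * (-1)%:P * 'X) * q^`())).
    by rewrite polyCN polyC1; ring.
  by rewrite hr hs polyCN polyC1; ring.
elim: n => [_|n IH nm].
  by rewrite muln0 coefM big_ord_recl big_ord0 /= !coef_bpoly // !expr0; ring.
have := congr1 (fun f : {poly rat} => f`_(2 * n).+1) hd.
have lt_m : ((2 * n).+1 < m)%N by lia.
rewrite coefB coefD !coefCM !coefMXn lt_m.
rewrite coefMX !coef_deriv /= IH; last lia.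
have -> : (2 * n.+1 = (2 * n).+2)%N by lia.
set g := (p * q)`_ _.
(* For [n = 0] the shifted coefficient is the default 0, which agrees with the factor [2 * n]. *)
have -> : (if ((2 * n).+1 < 2)%N then 0
           else (p * q)`_(((2 * n).+1 - 2).+1) *+ ((2 * n).+1 - 2).+1)
    = (4 ^+ n * (central_binom n)%:R) *+ (2 * n).
  case: n IH nm lt_m @g => [|n] IH nm lt_m g; first by rewrite mulr0n.
  have -> : (((2 * n.+1).+1 < 2)%N = false) by lia.
  have -> : (((2 * n.+1).+1 - 2).+1 = 2 * n.+1)%N by lia.
  by rewrite IH; last lia.
rewrite -(mulr_natl g) -(mulr_natl _ (2 * n)) => H.
have n0 : ((2 * n).+2%:R : rat) != 0 by rewrite Num.Theory.pnatr_eq0.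
apply: (mulfI n0).
have hS := central_binomS_rat n.
have -> : (2 * n).+2%:R * (4 ^+ n.+1 * (central_binom n.+1)%:R)
   = 2 * 4 ^+ n.+1 * (n.+1%:R * (central_binom n.+1)%:R) :> rat.
  by rewrite (_ : (2 * n).+2 = 2 * n.+1)%N ?natrM; [ring | lia].
move/eqP: H; rewrite hS exprS subr_eq => /eqP ->.
by rewrite natrM; ring.
Qed.

Lemma big_ord_double (V : nmodType) (F : nat -> V) n :
  \sum_(k < 2 * n) F k = \sum_(i < n) (F (2 * i)%N + F (2 * i).+1).
Proof.
elim: n => [|n IH]; first by rewrite muln0 !big_ord0.
rewrite [RHS]big_ord_recr /= -IH (_ : 2 * n.+1 = (2 * n).+2)%N; last lia.
by rewrite !big_ord_recr /= addrA.
Qed.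

Lemma sum_antidiagonal (V : nmodType) (F : nat -> nat -> V) n :
  \sum_(p : 'I_n.+1 * 'I_n.+1 | (p.1 + p.2)%N == n) F p.1 p.2
  = \sum_(i < n.+1) F i (n - i)%N.
Proof.
rewrite -(pair_big_dep xpredT (fun i j : 'I_n.+1 => (i + j)%N == n)
  (fun i j : 'I_n.+1 => F i j)) /=.
apply: eq_bigr => i _.
rewrite (big_pred1 (rev_ord i)) => [|j] /=; first by rewrite subSS.
apply/eqP/eqP => [h|->] /=; last by have := ltn_ord i; lia.
by apply: val_inj => /=; have := ltn_ord i; lia.
Qed.

(** The two terms contribute [2 (-1)^k C_k] and [2 C_k], which cancel for odd [k]. *)
Lemma coef_sqrt_diff m k : (k < m)%N ->
  ((1 - 4 * (-1)%:P * 'X) * bpoly (-1) m - (1 - 4 * 1%:P * 'X) * bpoly 1 m)`_k.+1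
  = if odd k then 0 else 4 * catalan k.
Proof.
move=> km; rewrite catalanE.
have E (e : rat) : (1 - 4 * e%:P * 'X) * bpoly e m
    = bpoly e m - (4 * e)%:P * (bpoly e m * 'X).
  by rewrite polyCM rmorph_nat; ring.
rewrite !E !coefB !coefCM !coefMX /= !coef_bpoly //; try lia.
rewrite !expr1n exprS -signr_odd.
by case: (odd k); rewrite /= ?expr0 ?expr1; field.
Qed.

Theorem theorem2 (n : nat) :
  \sum_(p : 'I_n.+1 * 'I_n.+1 | (p.1 + p.2)%N == n)
     catalan (2 * p.1) * (central_binom (2 * p.2))%:R
  = 4 ^+ n * (central_binom n)%:R.
Proof.
rewrite (sum_antidiagonal
  (fun i j => catalan (2 * i) * (central_binom (2 * j))%:R)).
(* The identity is read off in degree [2n+1], so truncating there loses nothing. *)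
pose m := (2 * n).+1.
set p := bpoly 1 m; set q := bpoly (-1) m.
pose s := (1 - 4 * 1%:P * 'X) * p; pose t := (1 - 4 * (-1)%:P * 'X) * q.
(* The cross terms [t * p - s * q] give [8 X p q]; [t * q] and [s * p] have no coefficient in degree
   [m]. *)
have prodE : (t - s) * (p + q) = 8%:P * (p * q * 'X) + t * q - s * p.
  by rewrite /s /t rmorph_nat polyCN polyC1; ring.
have := congr1 (fun f : {poly rat} => f`_m) prodE.
rewrite coefB coefD coefCM coefMX /= coef_bpoly_mulN; last by rewrite /m; lia.
rewrite !coef_bpoly_sqr // addr0 subr0 => H.
have e0 : (8 : rat) != 0 by [].
apply: (mulfI e0); rewrite -H coefM.
rewrite (_ : m.+1 = 2 * n.+1)%N; last by rewrite /m; lia.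
(* At index [2i] the cofactor is an odd coefficient of [p + q], hence 0. Index [2i+1] gives
   [4 C_{2i}] times [2 B_{2(n-i)}], matching the factor 8. *)
rewrite (big_ord_double (fun k => (t - s)`_k * (p + q)`_(m - k))).
rewrite mulr_sumr; apply: eq_bigr => i _.
have im : (i <= n)%N by rewrite -ltnS.
rewrite coef_sqrt_diff; last by rewrite /m; lia.
rewrite !(coefD p) !coef_bpoly; try by rewrite /m; lia.
rewrite (_ : m - 2 * i = (2 * (n - i)).+1)%N; last by rewrite /m; lia.
rewrite (_ : m - (2 * i).+1 = 2 * (n - i))%N; last by rewrite /m; lia.
by rewrite !expr1n exprS !exprM sqrrN !expr1n !mul2n odd_double; ring.
Qed.
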